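(* Let $\alpha\neq0$ be a real number. Any rotational (spacelike) $K^\alpha$-translator with timelike axis, normalized so that the axis is the $z$-axis and the speed is $\vec v=(0,0,1)$, is parametrized by $X(r,\theta)=(r\cos\theta,r\sin\theta,f(r))$, where $$f(r)=\begin{cases}\pm\displaystyle\int^r\Big(1-\frac1{m^2}e^{t^2}\Big)^{1/2}dt,\quad m>1, & \alpha=\frac12,\\[2mm] \pm\displaystyle\int^r\Big(1-\Big(m-\frac{2\alpha-1}{2\alpha}t^2\Big)^{\frac{2\alpha}{1-2\alpha}}\Big)^{1/2}dt,\quad m\in\mathbb R, & \alpha\neq\frac12.\end{cases}$$ The maximal domain of the function $f(r)$ is: 1. Case $\alpha=1/2$: $(0,\sqrt{\log m^2})$, where $m>1$. 2. Case $\alpha\in(0,1/2)$: $\Big(\sqrt{\frac{2\alpha}{2\alpha-1}m},\sqrt{\frac{2\alpha}{1-2\alpha}(1-m)}\Big)$ if $m<0$, or $\Big(0,\sqrt{\frac{2\alpha}{1-2\alpha}(1-m)}\Big)$ if $0\le m<1$. 3. Case $\alpha\notin[0,1/2]$: $\Big(0,\sqrt{\frac{2\alpha}{2\alpha-1}(m-1)}\Big)$, where $m>1$.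
   Context: $\mathbb R_1^3$ is $\mathbb R^3$ with the metric $\langle,\rangle=dx^2+dy^2-dz^2$. A surface is spacelike if its induced metric is Riemannian; then its unit normal $N$ satisfies $\langle N,N\rangle=\epsilon=-1$. The Gauss curvature is $K=\epsilon\det(A)$, where $AU=-\nabla^0_U N$ is the Weingarten map and $\nabla^0$ is the Levi-Civita connection of $\mathbb R_1^3$. In a local parametrization $X(u,v)$, $$K=-\frac{\det(X_u,X_v,X_{uu})\det(X_u,X_v,X_{vv})-\det(X_u,X_v,X_{uv})^2}{(EG-F^2)^2},$$ where $E=\langle X_u,X_u\rangle$, $F=\langle X_u,X_v\rangle$, $G=\langle X_v,X_v\rangle$. A spacelike surface is a $K^\alpha$-translator with speed $\vec v$ if $K>0$ and $K^\alpha=\langle N,\vec v\rangle$ everywhere, for a choice of unit normal $N$. A surface of revolution whose axis is the $z$-axis is one parametrized by $X(r,\theta)=(r\cos\theta,r\sin\theta,f(r))$ with $f$ smooth on an interval of $r>0$; it is spacelike iff $f'^2<1$. The symbol $\int^r$ denotes an antiderivative (defined up to an additive constant), and $m$ is a constant of integration. The maximal domain of $f$ is the largest open interval in $(0,\infty)$ on which the formula defines a smooth function for which $X$ is spacelike with $K>0$ and satisfies the translator equation; only the values of $m$ listed give a nonempty domain. *)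

(* Defs.v *)
From Stdlib Require Import Reals.
From Coquelicot Require Import Coquelicot.
Open Scope R_scope.

Record vec3 : Type := Vec { vx : R; vy : R; vz : R }.

Definition vadd (p q : vec3) : vec3 := Vec (vx p + vx q) (vy p + vy q) (vz p + vz q).
Definition vscal (c : R) (p : vec3) : vec3 := Vec (c * vx p) (c * vy p) (c * vz p).
Definition vopp (p : vec3) : vec3 := Vec (- vx p) (- vy p) (- vz p).

Definition lorentz (p q : vec3) : R := vx p * vx q + vy p * vy q - vz p * vz q.

Definition partial1 (X : R -> R -> vec3) (u v : R) : vec3 :=
  Vec (Derive (fun t => vx (X t v)) u)
      (Derive (fun t => vy (X t v)) u)
      (Derive (fun t => vz (X t v)) u).

Definition partial2 (X : R -> R -> vec3) (u v : R) : vec3 :=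
  Vec (Derive (fun t => vx (X u t)) v)
      (Derive (fun t => vy (X u t)) v)
      (Derive (fun t => vz (X u t)) v).

Definition has_partials (X : R -> R -> vec3) (u v : R) : Prop :=
  (ex_derive (fun t => vx (X t v)) u /\
   ex_derive (fun t => vy (X t v)) u /\
   ex_derive (fun t => vz (X t v)) u) /\
  (ex_derive (fun t => vx (X u t)) v /\
   ex_derive (fun t => vy (X u t)) v /\
   ex_derive (fun t => vz (X u t)) v).

(* The metric induced on the parameter domain is positive definite; in
   particular X is an immersion at (u, v). *)
Definition spacelike_at (X : R -> R -> vec3) (u v : R) : Prop :=
  has_partials X u v /\
  forall x y : R, ~ (x = 0 /\ y = 0) ->
    let w := vadd (vscal x (partial1 X u v)) (vscal y (partial2 X u v)) in
    0 < lorentz w w.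

Definition unit_normal_at (X N : R -> R -> vec3) (u v : R) : Prop :=
  has_partials N u v /\
  lorentz (N u v) (N u v) = -1 /\
  lorentz (N u v) (partial1 X u v) = 0 /\
  lorentz (N u v) (partial2 X u v) = 0.

(* (a b; c d) is the matrix of A U = - nabla^0_U N in the basis X_u, X_v.  The
   connection nabla^0 is flat, so nabla^0 along X_u, X_v is partial
   differentiation of the coordinates of N. *)
Definition is_weingarten (X N : R -> R -> vec3) (u v a b c d : R) : Prop :=
  vopp (partial1 N u v) =
    vadd (vscal a (partial1 X u v)) (vscal c (partial2 X u v)) /\
  vopp (partial2 N u v) =
    vadd (vscal b (partial1 X u v)) (vscal d (partial2 X u v)).

(* K = epsilon det A with epsilon = <N, N>. *)
Definition is_gauss_curvature (X N : R -> R -> vec3) (u v K : R) : Prop :=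
  exists a b c d : R,
    is_weingarten X N u v a b c d /\
    K = lorentz (N u v) (N u v) * (a * d - b * c).

Definition K_translator (alpha : R) (speed : vec3)
    (X : R -> R -> vec3) (D : R -> R -> Prop) : Prop :=
  (forall u v, D u v -> spacelike_at X u v) /\
  exists N : R -> R -> vec3,
    (forall u v, D u v -> unit_normal_at X N u v) /\
    (forall u v, D u v ->
       exists K : R, is_gauss_curvature X N u v K /\ 0 < K /\
         Rpower K alpha = lorentz (N u v) speed).

Definition between (a b : Rbar) (r : R) : Prop := Rbar_lt a r /\ Rbar_lt r b.

Definition positive_interval (a b : Rbar) : Prop :=
  Rbar_le (Finite 0) a /\ Rbar_lt a b.

Definition smooth_on (f : R -> R) (a b : Rbar) : Prop :=
  forall (n : nat) (r : R), between a b r -> ex_derive_n f n r.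

Definition revolution (f : R -> R) (r theta : R) : vec3 :=
  Vec (r * cos theta) (r * sin theta) (f r).

Definition rotational_K_translator (alpha : R) (f : R -> R) (a b : Rbar) : Prop :=
  positive_interval a b /\ smooth_on f a b /\
  K_translator alpha (Vec 0 0 1) (revolution f) (fun r _ => between a b r).

Definition power_base (alpha m t : R) : R :=
  m - (2 * alpha - 1) / (2 * alpha) * t ^ 2.

Definition radicand (alpha m t : R) : R :=
  if Req_EM_T alpha (1 / 2)
  then 1 - 1 / m ^ 2 * exp (t ^ 2)
  else 1 - Rpower (power_base alpha m t) (2 * alpha / (1 - 2 * alpha)).

(* Division, Rpower and sqrt are total functions in the library; this is where
   they have their usual meaning, real powers being those of a positive base. *)
Definition formula_defined (alpha m t : R) : Prop :=
  (if Req_EM_T alpha (1 / 2) then m <> 0 else 0 < power_base alpha m t) /\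
  0 <= radicand alpha m t.

(* s = 1 or s = -1 is the sign in front of the integral. *)
Definition given_by_formula (alpha s m : R) (f : R -> R) (a b : Rbar) : Prop :=
  (forall t, between a b t -> formula_defined alpha m t) /\
  exists F : R -> R,
    (forall t, between a b t -> is_derive F t (sqrt (radicand alpha m t))) /\
    (forall r, between a b r -> f r = s * F r).

(* The formula determines f up to an additive constant, whence both an existence
   and a universal clause. *)
Definition admissible_domain (alpha s m : R) (a b : Rbar) : Prop :=
  positive_interval a b /\
  (exists f, given_by_formula alpha s m f a b) /\
  (forall f, given_by_formula alpha s m f a b -> rotational_K_translator alpha f a b).

Definition maximal_domain (alpha s m : R) (a b : Rbar) : Prop :=
  admissible_domain alpha s m a b /\
  forall c d, admissible_domain alpha s m c d -> Rbar_le a c /\ Rbar_le d b.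

Definition empty_domain (alpha s m : R) : Prop :=
  forall a b, ~ admissible_domain alpha s m a b.

(* Main.v *)
(* Put p = 1 - f'^2.  The curvature is
   K = - f' f'' / (r p^2) = p' / (2 r p^2), and <N, (0,0,1)> = 1 / sqrt p (the
   sign of N is forced by K^alpha > 0), so the translator equation is
   p' = 2 r p^beta with beta = 2 - 1/(2 alpha).  It integrates to
   p = e^(r^2) / m^2 when beta = 1, and otherwise to
   p^(1 - beta) = m + (1 - beta) r^2.  As K > 0 forbids f' = 0, f' has a constant
   sign s and f' = s sqrt (1 - p).  The maximal domains are where p > 0 is
   defined and p < 1; outside their closure the formula itself is undefined. *)
Require Import Defs.
From Stdlib Require Import Reals Lra.
From Coquelicot Require Import Coquelicot.
Open Scope R_scope.

(** The height enters the translator equation only through [f'^2] and its derivative [2 f' f''].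
    Passing to [p] therefore lowers a second order equation to a separable first order one, and both
    signs [s] lead to the same [p]. The exponent beta comes from solving [K^alpha = p^(-1/2)] for
    [K = p^(-1/(2 alpha))] and inserting this in [p' = 2 r p^2 K].

    The solution depends on [t] only through [t^2], so each domain amounts to [A < t^2 < B]. Its two
    halves rest on different facts. Admissibility needs a strictly positive radicand, where the
    square root is smooth. Maximality needs only that the formula is undefined outside the closed
    range, because the radicand may vanish at an end.

    Two obstacles shape the proof: the normal [N] of a translator is an arbitrary witness and must
    first be identified pointwise, and a height function given by an integral must be shown to have
    derivatives of every order. *)

(** * Calculus on open intervals with extended real endpoints *)

Lemma between_convex (a b : Rbar) (x y t : R) :
  between a b x -> between a b y -> x <= t <= y -> between a b t.
Proof.
  unfold between; destruct a, b; simpl; intros; try tauto; lra.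
Qed.

Lemma between_locally (a b : Rbar) (r : R) :
  between a b r -> locally r (between a b).
Proof.
  intros [H1 H2]; apply (locally_interval _ _ a b H1 H2); now split.
Qed.

Lemma between_pos (a b : Rbar) (r : R) :
  positive_interval a b -> between a b r -> 0 < r.
Proof.
  intros [H1 _] [H2 _]; destruct a; simpl in *; try tauto; lra.
Qed.

Lemma between_inhabited (a b : Rbar) :
  positive_interval a b -> exists r, between a b r.
Proof.
  intros [H1 H2]; unfold between.
  destruct a as [a| |], b as [b| |]; simpl in *; try tauto.
  - exists ((a + b) / 2); lra.
  - exists (a + 1); split; trivial; lra.
Qed.

(** An endpoint beyond [[a, b]], finite or infinite, would leave a point of the interval outside
    [[a, b]]. This turns pointwise bounds into the comparison of endpoints that maximality asks
    for. *)
Lemma endpoints_le (a b : R) (c d : Rbar) :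
  positive_interval c d ->
  (forall t, between c d t -> a <= t <= b) ->
  Rbar_le a c /\ Rbar_le d b.
Proof.
  intros Hcd H.
  destruct (between_inhabited c d Hcd) as [x Hx].
  pose proof (H x Hx) as Hax. split.
  - apply Rbar_not_lt_le; intros Hlt.
    assert (Hm : exists t, between c d t /\ t < a).
    { destruct Hcd as [H0 _], Hx as [Hx1 Hx2].
      destruct c as [c| |]; simpl in *; try tauto.
      exists ((c + a) / 2); split; [split|].
      - simpl; lra.
      - destruct d; simpl in *; try tauto; lra.
      - lra. }
    destruct Hm as [t [Ht Hta]]. specialize (H t Ht); lra.
  - apply Rbar_not_lt_le; intros Hlt.
    assert (Hm : exists t, between c d t /\ b < t).
    { destruct Hx as [Hx1 Hx2].
      destruct d as [d| |]; simpl in *; try tauto.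
      - exists ((b + d) / 2); split; [split|].
        + destruct c; simpl in *; try tauto; lra.
        + simpl; lra.
        + lra.
      - exists (b + 1); split; [split|].
        + destruct c; simpl in *; try tauto; lra.
        + exact I.
        + lra. }
    destruct Hm as [t [Ht Hta]]. specialize (H t Ht); lra.
Qed.

Lemma derive_zero_constant (a b : Rbar) (h : R -> R) :
  (forall t, between a b t -> is_derive h t 0) ->
  forall x y, between a b x -> between a b y -> h x = h y.
Proof.
  intros Hh.
  assert (Hlt : forall x y, between a b x -> between a b y -> x < y -> h x = h y).
  { intros x y Hx Hy Hxy. apply eq_is_derive; [|exact Hxy].
    intros t Ht; apply Hh; exact (between_convex a b x y t Hx Hy Ht). }
  intros x y Hx Hy. destruct (Rtotal_order x y) as [H|[H|H]].
  - now apply Hlt.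
  - now subst.
  - symmetry; now apply Hlt.
Qed.

(** A change of sign would force a zero by the intermediate value theorem. *)
Lemma nonzero_constant_sign (a b : Rbar) (h : R -> R) :
  (exists r, between a b r) ->
  (forall t, between a b t -> continuity_pt h t) ->
  (forall t, between a b t -> h t <> 0) ->
  exists s, (s = 1 \/ s = -1) /\ forall t, between a b t -> 0 < s * h t.
Proof.
  intros [x0 Hx0] Hc Hn.
  (* [IVT_interv] expects a negative value on the left and a positive one on the right; the opposite
     order is handled by applying this to [- h]. *)
  assert (Hno : forall k : R -> R,
    (forall t, between a b t -> continuity_pt k t) ->
    (forall t, between a b t -> k t <> 0) ->
    forall x y, between a b x -> between a b y -> x < y -> 0 < k y -> 0 < k x).
  { intros k Hkc Hkn x y Hx Hy Hxy Hky.
    destruct (Rlt_or_le 0 (k x)) as [H|H]; [exact H|].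
    assert (Hkx : k x < 0) by (pose proof (Hkn x Hx); lra).
    destruct (Ranalysis5.IVT_interv k x y) as [z [Hz Hkz]]; trivial.
    - intros t Ht; apply Hkc; exact (between_convex a b x y t Hx Hy Ht).
    - destruct (Hkn z (between_convex a b x y z Hx Hy Hz) Hkz). }
  assert (Hc' : forall t, between a b t -> continuity_pt (fun t => - h t) t).
  { intros t Ht; apply (continuity_pt_opp h); now apply Hc. }
  assert (Hn' : forall t, between a b t -> - h t <> 0).
  { intros t Ht; pose proof (Hn t Ht); lra. }
  assert (Hprod : forall x y, between a b x -> between a b y -> 0 < h x -> 0 < h y).
  { intros x y Hx Hy Hp. destruct (Rtotal_order x y) as [H|[H|H]].
    - destruct (Rlt_or_le 0 (h y)) as [H1|H1]; [exact H1|].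
      assert (0 < - h x); [|lra].
      apply (Hno (fun t => - h t) Hc' Hn' x y Hx Hy H).
      pose proof (Hn y Hy); lra.
    - now subst.
    - exact (Hno h Hc Hn y x Hy Hx H Hp). }
  destruct (Rlt_or_le 0 (h x0)) as [H|H].
  - exists 1; split; [now left|]. intros t Ht.
    rewrite Rmult_1_l; exact (Hprod x0 t Hx0 Ht H).
  - exists (-1); split; [now right|]. intros t Ht.
    destruct (Rlt_or_le 0 (h t)) as [H1|H1].
    + pose proof (Hprod t x0 Ht Hx0 H1); lra.
    + pose proof (Hn t Ht); lra.
Qed.

(** By induction, each iterated derivative coincides on the interval with a member of [C]. The
    agreement holds only on the interval, so it is transported through neighbourhoods, which exist
    because the interval is open. *)
Lemma smooth_of_derivative_closed (a b : Rbar) (C : (R -> R) -> Prop) :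
  (forall h, C h -> exists h', C h' /\ forall t, between a b t -> is_derive h t (h' t)) ->
  forall h, C h -> smooth_on h a b.
Proof.
  intros HC h Hh.
  assert (H : forall n, exists k, C k /\ forall t, between a b t -> k t = Derive_n h n t).
  { intros n; induction n as [|n [k [Hk1 Hk2]]].
    - now exists h.
    - destruct (HC k Hk1) as [k' [Hk'1 Hk'2]].
      exists k'; split; trivial. intros t Ht; simpl.
      rewrite <- (Derive_ext_loc k).
      + symmetry; apply is_derive_unique; auto.
      + apply (filter_imp (between a b)); auto using between_locally. }
  intros [|n] r Hr; [exact I|].
  destruct (H n) as [k [Hk1 Hk2]], (HC k Hk1) as [k' [_ Hk']].
  simpl. apply (ex_derive_ext_loc k).
  - apply (filter_imp (between a b)); auto using between_locally.
  - exists (k' r); auto.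
Qed.

(** * Normal, Weingarten map and curvature of a surface of revolution *)

Lemma partial1_revolution (f : R -> R) (r theta : R) :
  partial1 (revolution f) r theta = Vec (cos theta) (sin theta) (Derive f r).
Proof.
  unfold partial1, revolution; simpl. f_equal.
  - apply is_derive_unique; auto_derive; trivial; ring.
  - apply is_derive_unique; auto_derive; trivial; ring.
Qed.

Lemma partial2_revolution (f : R -> R) (r theta : R) :
  partial2 (revolution f) r theta = Vec (- (r * sin theta)) (r * cos theta) 0.
Proof.
  unfold partial2, revolution; simpl. f_equal.
  - apply is_derive_unique; auto_derive; trivial; ring.
  - apply is_derive_unique; auto_derive; trivial; ring.
  - apply is_derive_unique; auto_derive; trivial; ring.
Qed.

(** The normal with negative third coordinate: the metric is negative in [z], so this is the choice
    with positive product with [(0, 0, 1)]. *)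
Definition revolution_normal (f : R -> R) (r theta : R) : vec3 :=
  let W := sqrt (1 - Derive f r ^ 2) in
  Vec (- (Derive f r / W * cos theta)) (- (Derive f r / W * sin theta)) (- / W).

Definition revolution_curvature (f : R -> R) (r : R) : R :=
  - (Derive f r * Derive_n f 2 r) / (r * (1 - Derive f r ^ 2) ^ 2).

(** With [W = sqrt (1 - f'^2)], the quotient rule gives [f'' (W^2 + f'^2) / W^3], and
    [W^2 + f'^2 = 1]. *)
Lemma is_derive_normal_horizontal (f : R -> R) (r : R) :
  ex_derive_n f 2 r -> Derive f r ^ 2 < 1 ->
  is_derive (fun t => Derive f t / sqrt (1 - Derive f t ^ 2)) r
    (Derive_n f 2 r / sqrt (1 - Derive f r ^ 2) ^ 3).
Proof.
  intros Hf Hsp.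
  assert (HW : 0 < sqrt (1 - Derive f r ^ 2)) by (apply sqrt_lt_R0; lra).
  assert (HW2 := pow2_sqrt (1 - Derive f r ^ 2) ltac:(lra)).
  evar_last.
  { apply (is_derive_div (Derive f) (fun t => sqrt (1 - Derive f t ^ 2)) r
             (Derive_n f 2 r) (- (Derive f r * Derive_n f 2 r) / sqrt (1 - Derive f r ^ 2))).
    - apply Derive_correct; exact Hf.
    - evar_last.
      { apply (is_derive_comp sqrt (fun t => 1 - Derive f t ^ 2)).
        - apply is_derive_Reals, derivable_pt_lim_sqrt; lra.
        - apply (is_derive_minus (fun _ => 1)).
          + apply is_derive_const.
          + apply (is_derive_pow (Derive f) 2), Derive_correct; exact Hf. }
      change (Derive (Derive f) r) with (Derive_n f 2 r).
      unfold scal, minus, plus, opp, zero; cbn -[Derive_n Derive pow sqrt]; unfold mult; cbn -[Derive_n Derive pow sqrt].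
      field; lra.
    - lra. }
  set (w := sqrt (1 - Derive f r ^ 2)) in *.
  replace (Derive_n f 2 r * w - Derive f r * (- (Derive f r * Derive_n f 2 r) / w))
    with (Derive_n f 2 r / w).
  - field; lra.
  - apply (Rmult_eq_reg_r w); [|lra]. field_simplify; [|lra..].
    rewrite HW2; ring.
Qed.

Lemma is_derive_normal_vertical (f : R -> R) (r : R) :
  ex_derive_n f 2 r -> Derive f r ^ 2 < 1 ->
  is_derive (fun t => / sqrt (1 - Derive f t ^ 2)) r
    (Derive f r * Derive_n f 2 r / sqrt (1 - Derive f r ^ 2) ^ 3).
Proof.
  intros Hf Hsp.
  assert (HW : 0 < sqrt (1 - Derive f r ^ 2)) by (apply sqrt_lt_R0; lra).
  evar_last.
  { apply is_derive_inv with (l := - (Derive f r * Derive_n f 2 r) / sqrt (1 - Derive f r ^ 2)).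
    - evar_last.
      { apply (is_derive_comp sqrt (fun t => 1 - Derive f t ^ 2)).
        - apply is_derive_Reals, derivable_pt_lim_sqrt; lra.
        - apply (is_derive_minus (fun _ => 1)).
          + apply is_derive_const.
          + apply (is_derive_pow (Derive f) 2), Derive_correct; exact Hf. }
      change (Derive (Derive f) r) with (Derive_n f 2 r).
      unfold scal, minus, plus, opp, zero; cbn -[Derive_n Derive pow sqrt]; unfold mult; cbn -[Derive_n Derive pow sqrt].
      field; lra.
    - lra. }
  cbv beta; set (w := sqrt _) in *; field; lra.
Qed.

Lemma has_partials_revolution_normal (f : R -> R) (r theta : R) :
  ex_derive_n f 2 r -> Derive f r ^ 2 < 1 ->
  has_partials (revolution_normal f) r theta.
Proof.
  intros Hf Hsp.
  pose proof (is_derive_normal_horizontal f r Hf Hsp) as Hh.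
  pose proof (is_derive_normal_vertical f r Hf Hsp) as Hv.
  unfold has_partials, revolution_normal; cbn -[Derive pow].
  repeat split.
  - apply ex_derive_opp with (f := fun t => Derive f t / sqrt (1 - Derive f t ^ 2) * cos theta).
    apply ex_derive_mult; [eexists; exact Hh | apply ex_derive_const].
  - apply ex_derive_opp with (f := fun t => Derive f t / sqrt (1 - Derive f t ^ 2) * sin theta).
    apply ex_derive_mult; [eexists; exact Hh | apply ex_derive_const].
  - apply ex_derive_opp with (f := fun t => / sqrt (1 - Derive f t ^ 2)).
    eexists; exact Hv.
  - auto_derive; trivial.
  - auto_derive; trivial.
  - apply ex_derive_const.
Qed.

(** Meridians are lines of curvature: the scalar is the principal curvature in the direction
    [X_r]. *)
Lemma partial1_revolution_normal (f : R -> R) (r theta : R) :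
  ex_derive_n f 2 r -> Derive f r ^ 2 < 1 ->
  partial1 (revolution_normal f) r theta =
  vopp (vscal (Derive_n f 2 r / sqrt (1 - Derive f r ^ 2) ^ 3)
         (partial1 (revolution f) r theta)).
Proof.
  intros Hf Hsp.
  assert (Hh : Derive (fun t => Derive f t / sqrt (1 - Derive f t ^ 2)) r = _)
    by exact (is_derive_unique _ _ _ (is_derive_normal_horizontal f r Hf Hsp)).
  assert (Hv : Derive (fun t => / sqrt (1 - Derive f t ^ 2)) r = _)
    by exact (is_derive_unique _ _ _ (is_derive_normal_vertical f r Hf Hsp)).
  rewrite partial1_revolution.
  unfold partial1, revolution_normal, vopp, vscal; cbn -[Derive Derive_n pow].
  rewrite !Derive_opp, !Derive_scal_l, Hh, Hv.
  f_equal; field; apply Rgt_not_eq, sqrt_lt_R0; lra.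
Qed.

(** Parallels are lines of curvature as well, with this scalar as principal curvature. *)
Lemma partial2_revolution_normal (f : R -> R) (r theta : R) :
  0 < r -> Derive f r ^ 2 < 1 ->
  partial2 (revolution_normal f) r theta =
  vopp (vscal (Derive f r / (r * sqrt (1 - Derive f r ^ 2)))
         (partial2 (revolution f) r theta)).
Proof.
  intros Hr Hsp.
  assert (HW : 0 < sqrt (1 - Derive f r ^ 2)) by (apply sqrt_lt_R0; lra).
  rewrite partial2_revolution.
  unfold partial2, revolution_normal, vopp, vscal; cbn -[Derive Derive_n pow].
  set (w := sqrt _) in *; set (p := Derive f r).
  clearbody p w. f_equal; apply is_derive_unique; auto_derive; trivial; field; lra.
Qed.

(** The two factors are the principal curvatures of the meridian and of the parallel; the leading
    minus sign is epsilon. *)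
Lemma revolution_curvature_normal (f : R -> R) (r : R) :
  0 < r -> Derive f r ^ 2 < 1 ->
  revolution_curvature f r =
  - (Derive_n f 2 r / sqrt (1 - Derive f r ^ 2) ^ 3 *
     (Derive f r / (r * sqrt (1 - Derive f r ^ 2)))).
Proof.
  intros Hr Hsp. unfold revolution_curvature.
  assert (HW : 0 < sqrt (1 - Derive f r ^ 2)) by (apply sqrt_lt_R0; lra).
  rewrite <- (pow2_sqrt (1 - Derive f r ^ 2)) at 1 by lra.
  field; lra.
Qed.

Lemma revolution_normal_unit (f : R -> R) (r theta : R) :
  Derive f r ^ 2 < 1 ->
  lorentz (revolution_normal f r theta) (revolution_normal f r theta) = -1.
Proof.
  intros Hsp.
  assert (HW : 0 < sqrt (1 - Derive f r ^ 2)) by (apply sqrt_lt_R0; lra).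
  assert (HW2 := pow2_sqrt (1 - Derive f r ^ 2) ltac:(lra)).
  assert (Hcs : sin theta ^ 2 + cos theta ^ 2 = 1)
    by (pose proof (sin2_cos2 theta); unfold Rsqr in *; lra).
  unfold lorentz, revolution_normal; cbn -[Derive pow].
  set (w := sqrt _) in *.
  transitivity ((Derive f r ^ 2 * (sin theta ^ 2 + cos theta ^ 2) - 1) / w ^ 2).
  - field; lra.
  - rewrite Hcs, HW2. field; lra.
Qed.

(** Orthogonality to [X_theta] makes the horizontal part of [n] radial, orthogonality to [X_r] makes
    that part [n3 f'], the norm gives [(n3 W)^2 = 1], and positivity selects the root. The
    identification is pointwise, so no continuity of [N] is involved. *)
Lemma unit_normal_revolution (f : R -> R) (r theta : R) (n : vec3) :
  0 < r -> Derive f r ^ 2 < 1 ->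
  lorentz n n = -1 ->
  lorentz n (partial1 (revolution f) r theta) = 0 ->
  lorentz n (partial2 (revolution f) r theta) = 0 ->
  0 < lorentz n (Vec 0 0 1) ->
  n = revolution_normal f r theta.
Proof.
  rewrite partial1_revolution, partial2_revolution.
  destruct n as [n1 n2 n3].
  unfold lorentz, revolution_normal; cbn -[Derive pow].
  intros Hr Hsp H0 H1 H2 H3.
  assert (HW : 0 < sqrt (1 - Derive f r ^ 2)) by (apply sqrt_lt_R0; lra).
  assert (HW2 := pow2_sqrt (1 - Derive f r ^ 2) ltac:(lra)).
  assert (Hcs : sin theta ^ 2 + cos theta ^ 2 = 1)
    by (pose proof (sin2_cos2 theta); unfold Rsqr in *; lra).
  set (w := sqrt _) in *. set (p := Derive f r) in *.
  set (c := cos theta) in *. set (e := sin theta) in *.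
  assert (H2' : n2 * c = n1 * e).
  { apply (Rmult_eq_reg_l r); lra. }
  (* [H1] and [H2'] form a linear system for [(n1, n2)] whose matrix is a rotation up to sign;
     inserting [e^2 + c^2 = 1] inverts it. *)
  assert (E1 : n1 = n3 * p * c).
  { transitivity (n1 * (e ^ 2 + c ^ 2)); [rewrite Hcs; ring|].
    replace (n1 * (e ^ 2 + c ^ 2)) with (n1 * e * e + n1 * c * c) by ring.
    rewrite <- H2'.
    replace (n2 * c * e + n1 * c * c) with ((n1 * c + n2 * e - n3 * p) * c + n3 * p * c) by ring.
    rewrite H1; ring. }
  assert (E2 : n2 = n3 * p * e).
  { transitivity (n2 * (e ^ 2 + c ^ 2)); [rewrite Hcs; ring|].
    replace (n2 * (e ^ 2 + c ^ 2)) with (n2 * e * e + n2 * c * c) by ring.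
    rewrite H2'.
    replace (n2 * e * e + n1 * e * c) with ((n1 * c + n2 * e - n3 * p) * e + n3 * p * e) by ring.
    rewrite H1; ring. }
  assert (E3 : (n3 * w) ^ 2 = 1).
  { rewrite Rpow_mult_distr, HW2.
    rewrite E1, E2 in H0.
    replace 1 with (e ^ 2 + c ^ 2) at 1 by exact Hcs.
    nra. }
  assert (E4 : n3 = - / w).
  { apply (Rmult_eq_reg_r w); [|lra].
    replace (- / w * w) with (-1) by (field; lra).
    assert (n3 * w < 0) by nra. nra. }
  rewrite E1, E2, E4. f_equal; field; lra.
Qed.

(** Rotational symmetry eliminates [theta], and the unknown [N] and Weingarten matrix are replaced
    by explicit functions of [f'] and [f'']. What remains is an ordinary differential equation in
    [r]. *)
Lemma revolution_translator_iff (alpha : R) (f : R -> R) (a b : Rbar) :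
  positive_interval a b -> smooth_on f a b ->
  (K_translator alpha (Vec 0 0 1) (revolution f) (fun r _ => between a b r) <->
   forall r, between a b r ->
     Derive f r ^ 2 < 1 /\ 0 < revolution_curvature f r /\
     Rpower (revolution_curvature f r) alpha = / sqrt (1 - Derive f r ^ 2)).
Proof.
  intros Hab Hf. split.
  - intros [Hs [N [HN HK]]].
    assert (Hsp : forall r, between a b r -> Derive f r ^ 2 < 1).
    { intros r Hr. destruct (Hs r 0 Hr) as [_ H].
      (* The direction [X_r] has squared length [1 - f'^2]. *)
      specialize (H 1 0 ltac:(lra)). cbv zeta in H.
      rewrite partial1_revolution, partial2_revolution, cos_0, sin_0 in H.
      unfold lorentz, vadd, vscal in H; cbn -[Derive pow] in H. lra. }
    assert (HNe : forall r theta, between a b r -> N r theta = revolution_normal f r theta).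
    { intros r theta Hr. destruct (HN r theta Hr) as (_ & H0 & H1 & H2).
      destruct (HK r theta Hr) as (K & _ & _ & HK').
      apply unit_normal_revolution; auto.
      - exact (between_pos a b r Hab Hr).
      - rewrite <- HK'; apply exp_pos. }
    intros r Hr. split; [exact (Hsp r Hr)|].
    pose proof (between_pos a b r Hab Hr) as Hr0.
    pose proof (Hsp r Hr) as Hspr.
    destruct (HK r 0 Hr) as (K & (wa & wb & wc & wd & (W1 & W2) & HKe) & HKp & HKa).
    (* [N] is the explicit normal on a neighbourhood in [r] and for every [theta], hence the partial
       derivatives agree too. *)
    assert (P1 : partial1 N r 0 = partial1 (revolution_normal f) r 0).
    { unfold partial1; f_equal; apply Derive_ext_loc, (filter_imp (between a b));
        auto using between_locally; intros t Ht; now rewrite HNe. }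
    assert (P2 : partial2 N r 0 = partial2 (revolution_normal f) r 0).
    { unfold partial2; f_equal; apply Derive_ext; intros t; now rewrite HNe. }
    rewrite P1, partial1_revolution_normal, partial1_revolution, partial2_revolution,
      cos_0, sin_0 in W1 by (auto; exact (Hf 2%nat r Hr)).
    rewrite P2, partial2_revolution_normal, partial1_revolution, partial2_revolution,
      cos_0, sin_0 in W2 by auto.
    rewrite HNe in HKe, HKa by exact Hr.
    rewrite revolution_normal_unit in HKe by exact Hspr.
    (* At [theta = 0], [X_r] is [(1, 0, f')] and [X_theta] is [(0, r, 0)], so these three
       coordinates isolate [wa], [wb] and [wd]. With [wb = 0] the determinant is [wa * wd]. *)
    apply (f_equal vx) in W1. pose proof (f_equal vy W2) as W3. apply (f_equal vx) in W2.
    unfold vopp, vadd, vscal in W1, W2, W3; cbn -[Derive Derive_n pow] in W1, W2, W3.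
    assert (Ewa : wa = Derive_n f 2 r / sqrt (1 - Derive f r ^ 2) ^ 3) by lra.
    assert (Ewb : wb = 0) by lra.
    assert (Ewd : wd = Derive f r / (r * sqrt (1 - Derive f r ^ 2))).
    { apply (Rmult_eq_reg_r (r * 1)); lra. }
    assert (EK : K = revolution_curvature f r).
    { rewrite revolution_curvature_normal by auto.
      rewrite HKe, Ewb, <- Ewa, <- Ewd; ring. }
    rewrite <- EK. split; [exact HKp|].
    rewrite HKa. unfold lorentz, revolution_normal; cbn -[Derive pow]. ring.
  - intros H. split.
    + intros r theta Hr. destruct (H r Hr) as [Hsp _].
      pose proof (between_pos a b r Hab Hr) as Hr0.
      assert (Hd : ex_derive f r) by exact (Hf 1%nat r Hr).
      split.
      * unfold has_partials, revolution; simpl. repeat split; auto_derive; trivial.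
      * intros x y Hxy w; subst w. rewrite partial1_revolution, partial2_revolution.
        assert (Hcs : sin theta ^ 2 + cos theta ^ 2 = 1)
          by (pose proof (sin2_cos2 theta); unfold Rsqr in *; lra).
        unfold lorentz, vadd, vscal; cbn -[Derive pow].
        (* After [sin^2 + cos^2 = 1] this is the first fundamental form
           [(1 - f'^2) x^2 + r^2 y^2]. *)
        match goal with |- 0 < ?e => replace e with
          ((sin theta ^ 2 + cos theta ^ 2) * (x ^ 2 + r ^ 2 * y ^ 2) - x ^ 2 * Derive f r ^ 2)
          by ring end.
        rewrite Hcs.
        replace (1 * (x ^ 2 + r ^ 2 * y ^ 2) - x ^ 2 * Derive f r ^ 2)
          with (x ^ 2 * (1 - Derive f r ^ 2) + (r * y) ^ 2) by ring.
        destruct (Req_dec x 0) as [Hx|Hx].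
        -- assert (Hy : y <> 0) by tauto.
           assert (0 < (r * y) ^ 2) by (apply pow2_gt_0, Rmult_integral_contrapositive; lra).
           rewrite Hx; lra.
        -- assert (0 < x ^ 2 * (1 - Derive f r ^ 2))
             by (apply Rmult_lt_0_compat; [now apply pow2_gt_0|lra]).
           pose proof (pow2_ge_0 (r * y)); lra.
    + exists (revolution_normal f). split.
      * intros r theta Hr. destruct (H r Hr) as [Hsp _].
        assert (HW : 0 < sqrt (1 - Derive f r ^ 2)) by (apply sqrt_lt_R0; lra).
        assert (Hcs : sin theta ^ 2 + cos theta ^ 2 = 1)
          by (pose proof (sin2_cos2 theta); unfold Rsqr in *; lra).
        split; [|repeat apply conj].
        -- apply has_partials_revolution_normal; [exact (Hf 2%nat r Hr)|exact Hsp].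
        -- now apply revolution_normal_unit.
        -- rewrite partial1_revolution. unfold lorentz, revolution_normal; cbn -[Derive pow].
           transitivity (Derive f r / sqrt (1 - Derive f r ^ 2) *
             (1 - (sin theta ^ 2 + cos theta ^ 2))); [field; lra | rewrite Hcs; ring].
        -- rewrite partial2_revolution. unfold lorentz, revolution_normal; cbn -[Derive pow].
           field; lra.
      * intros r theta Hr. destruct (H r Hr) as (Hsp & HKp & HKa).
        pose proof (between_pos a b r Hab Hr) as Hr0.
        exists (revolution_curvature f r). split; [|split; [exact HKp|]].
        -- exists (Derive_n f 2 r / sqrt (1 - Derive f r ^ 2) ^ 3), 0, 0,
             (Derive f r / (r * sqrt (1 - Derive f r ^ 2))).
           split; [split|].
           ++ rewrite partial1_revolution_normal by (auto; exact (Hf 2%nat r Hr)).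
              destruct (partial1 (revolution f) r theta), (partial2 (revolution f) r theta).
              unfold vopp, vadd, vscal; cbn -[Derive Derive_n pow]; f_equal; ring.
           ++ rewrite partial2_revolution_normal by auto.
              destruct (partial1 (revolution f) r theta), (partial2 (revolution f) r theta).
              unfold vopp, vadd, vscal; cbn -[Derive Derive_n pow]; f_equal; ring.
           ++ rewrite revolution_normal_unit, revolution_curvature_normal by auto. ring.
        -- rewrite HKa. unfold lorentz, revolution_normal; cbn -[Derive pow]. ring.
Qed.

(** * The function p read off from the formula, and its differential equation *)

Definition profile (alpha m t : R) : R := 1 - radicand alpha m t.

(** The part of [formula_defined] that gives the real power its meaning. Positivity of the profile
    and its differential equation hold here even where the radicand is negative. *)
Definition profile_defined (alpha m t : R) : Prop :=
  if Req_EM_T alpha (1 / 2) then m <> 0 else 0 < power_base alpha m t.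

Lemma profile_pos (alpha m t : R) :
  profile_defined alpha m t -> 0 < profile alpha m t.
Proof.
  unfold profile_defined, profile, radicand.
  destruct (Req_EM_T alpha (1 / 2)) as [_|_]; intros H.
  - replace (1 - (1 - 1 / m ^ 2 * exp (t ^ 2))) with (/ m ^ 2 * exp (t ^ 2)) by (field; auto).
    apply Rmult_lt_0_compat; [|apply exp_pos].
    now apply Rinv_0_lt_compat, pow2_gt_0.
  - replace (1 - _) with (Rpower (power_base alpha m t) (2 * alpha / (1 - 2 * alpha))) by ring.
    apply exp_pos.
Qed.

Lemma is_derive_Rpower (p : R -> R) (c t l : R) :
  0 < p t -> is_derive p t l ->
  is_derive (fun x => Rpower (p x) c) t (c * Rpower (p t) (c - 1) * l).
Proof.
  intros Hp Hd. evar_last.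
  { apply (is_derive_comp (fun y => Rpower y c) p); [|exact Hd].
    apply is_derive_Reals, derivable_pt_lim_power; exact Hp. }
  unfold scal; simpl; unfold mult; simpl. ring.
Qed.

(** For [alpha <> 1/2], put [e = 2 alpha / (1 - 2 alpha)]. The base has derivative [2 t / e], so the
    power has derivative [2 t base^(e - 1)], and [e - 1 = e beta]. For [alpha = 1/2], beta is 1 and
    the profile is an exponential of [t^2]. *)
Lemma is_derive_profile (alpha m t : R) :
  alpha <> 0 -> profile_defined alpha m t ->
  is_derive (profile alpha m) t (2 * t * Rpower (profile alpha m t) (2 - 1 / (2 * alpha))).
Proof.
  intros Ha H. pose proof (profile_pos alpha m t H) as Hp. revert H Hp.
  unfold profile_defined, profile, radicand.
  destruct (Req_EM_T alpha (1 / 2)) as [E|E]; intros H Hp.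
  - replace (2 - 1 / (2 * alpha)) with 1 by (subst; field).
    rewrite Rpower_1 by exact Hp.
    auto_derive; [trivial|]. simpl; field; exact H.
  - set (e := 2 * alpha / (1 - 2 * alpha)).
    assert (Hb : is_derive (power_base alpha m) t (- ((2 * alpha - 1) / (2 * alpha)) * (2 * t))).
    { unfold power_base; auto_derive; [trivial|]. field; exact Ha. }
    apply (is_derive_ext (fun x => Rpower (power_base alpha m x) e)).
    { intros x. apply (Rminus_diag_uniq (Rpower _ _)); ring. }
    evar_last; [exact (is_derive_Rpower _ e t _ H Hb)|].
    replace (1 - (1 - Rpower (power_base alpha m t) e))
      with (Rpower (power_base alpha m t) e) by ring.
    rewrite Rpower_mult.
    assert (1 - 2 * alpha <> 0) by lra.
    replace (e * (2 - 1 / (2 * alpha))) with (e - 1) by (unfold e; field; auto).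
    replace (- ((2 * alpha - 1) / (2 * alpha))) with (/ e) by (unfold e; field; auto).
    field. unfold e. apply Rmult_integral_contrapositive; split; [lra|].
    now apply Rinv_neq_0_compat.
Qed.

Lemma Rpower_eq_inv_sqrt (alpha k p : R) :
  alpha <> 0 -> 0 < k -> 0 < p ->
  (Rpower k alpha = / sqrt p <-> k = Rpower p (- (1 / (2 * alpha)))).
Proof.
  intros Ha Hk Hp.
  rewrite <- Rpower_sqrt, <- Rpower_Ropp by exact Hp. split; intros H.
  - rewrite <- (Rpower_1 k) at 1 by exact Hk.
    replace 1 with (alpha * / alpha) at 1 by (field; exact Ha).
    rewrite <- Rpower_mult, H, Rpower_mult. f_equal; field; exact Ha.
  - rewrite H, Rpower_mult. f_equal; field; exact Ha.
Qed.

(* The ODE p' = 2 t p^beta makes this class closed under differentiation, whence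
   the smoothness of the height function F, F' = sqrt (1 - p). *)
Inductive translator_class (F p : R -> R) : (R -> R) -> Prop :=
| tc_height : translator_class F p F
| tc_const c : translator_class F p (fun _ => c)
| tc_id : translator_class F p (fun t => t)
| tc_power c : translator_class F p (fun t => Rpower (p t) c)
| tc_slope : translator_class F p (fun t => sqrt (1 - p t))
| tc_inv_slope : translator_class F p (fun t => / sqrt (1 - p t))
| tc_plus g h : translator_class F p g -> translator_class F p h ->
    translator_class F p (fun t => g t + h t)
| tc_mult g h : translator_class F p g -> translator_class F p h ->
    translator_class F p (fun t => g t * h t).

Lemma is_derive_slope (p : R -> R) (t l : R) :
  p t < 1 -> is_derive p t l ->
  is_derive (fun x => sqrt (1 - p x)) t (- l / (2 * sqrt (1 - p t))).
Proof.
  intros H Hp.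
  assert (0 < sqrt (1 - p t)) by (apply sqrt_lt_R0; lra).
  evar_last.
  { apply (is_derive_comp sqrt (fun x => 1 - p x)).
    - apply is_derive_Reals, derivable_pt_lim_sqrt; lra.
    - apply (is_derive_minus (fun _ => 1) p); [apply is_derive_const|exact Hp]. }
  unfold scal, minus, plus, opp, zero; simpl; unfold mult; simpl. field; lra.
Qed.

(** Each generator differentiates to a sum or product of generators: the differential equation
    replaces [p'] by a power of [p], and the reciprocal slope is a generator because differentiating
    the square root produces it. The bounds [0 < p < 1] keep powers and roots differentiable. *)
Lemma translator_class_derive (F p : R -> R) (a b : Rbar) (beta : R) :
  (forall t, between a b t -> 0 < p t < 1) ->
  (forall t, between a b t -> is_derive p t (2 * t * Rpower (p t) beta)) ->
  (forall t, between a b t -> is_derive F t (sqrt (1 - p t))) ->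
  forall h, translator_class F p h ->
  exists h', translator_class F p h' /\ forall t, between a b t -> is_derive h t (h' t).
Proof.
  intros Hp Hdp HdF h Hh.
  assert (Hq : forall t, between a b t -> 0 < sqrt (1 - p t)).
  { intros t Ht; apply sqrt_lt_R0; pose proof (Hp t Ht); lra. }
  induction Hh as [|c| |c| | |g h _ [g' [Hg1 Hg2]] _ [h' [Hh1 Hh2]]
                            |g h Hg0 [g' [Hg1 Hg2]] Hh0 [h' [Hh1 Hh2]]].
  - exists (fun t => sqrt (1 - p t)); split; [constructor|exact HdF].
  - exists (fun _ => 0); split; [constructor|]. intros; apply is_derive_Reals, derivable_pt_lim_const.
  - exists (fun _ => 1); split; [constructor|]. intros; apply is_derive_Reals, derivable_pt_lim_id.
  - exists (fun t => c * Rpower (p t) (c - 1) * (2 * t * Rpower (p t) beta)).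
    split; [repeat constructor|].
    intros t Ht; apply is_derive_Rpower; [apply Hp|apply Hdp]; exact Ht.
  - exists (fun t => (-1 * t * Rpower (p t) beta) * / sqrt (1 - p t)).
    split; [repeat constructor|].
    intros t Ht; evar_last.
    { apply is_derive_slope; [apply (Hp t Ht)|apply (Hdp t Ht)]. }
    pose proof (Hq t Ht); field; lra.
  - exists (fun t => t * Rpower (p t) beta *
                     (/ sqrt (1 - p t) * (/ sqrt (1 - p t) * / sqrt (1 - p t)))).
    split; [repeat constructor|].
    intros t Ht; evar_last.
    { apply (is_derive_inv (fun x => sqrt (1 - p x))).
      - apply is_derive_slope; [apply (Hp t Ht)|apply (Hdp t Ht)].
      - apply Rgt_not_eq, Hq, Ht. }
    pose proof (Hq t Ht); cbv beta; field; lra.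
  - exists (fun t => g' t + h' t); split; [now constructor|].
    intros t Ht; apply (is_derive_plus g h); auto.
  - exists (fun t => g' t * h t + g t * h' t); split; [now repeat constructor|].
    intros t Ht; apply (is_derive_mult g h); auto. exact Rmult_comm.
Qed.

Lemma sign_square (s : R) : s = 1 \/ s = -1 -> s * s = 1.
Proof. intros [H|H]; subst; ring. Qed.

(** * From the formula to translators and back *)

(** A strictly positive radicand means [p < 1], so the square root is smooth along the interval. The
    curvature contains [s] only as [s * s = 1], hence both signs are treated together. *)
Lemma formula_translator (alpha s m : R) (f : R -> R) (a b : Rbar) :
  alpha <> 0 -> s = 1 \/ s = -1 -> positive_interval a b ->
  (forall t, between a b t -> profile_defined alpha m t /\ 0 < radicand alpha m t) ->
  given_by_formula alpha s m f a b ->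
  rotational_K_translator alpha f a b.
Proof.
  intros Ha Hs Hab Hdef [_ [F [HF Hf]]].
  set (beta := 2 - 1 / (2 * alpha)).
  set (p := profile alpha m).
  assert (Hrad : forall t, radicand alpha m t = 1 - p t) by (intros; unfold p, profile; ring).
  assert (Hp : forall t, between a b t -> 0 < p t < 1).
  { intros t Ht; destruct (Hdef t Ht) as [H1 H2]. rewrite Hrad in H2.
    pose proof (profile_pos alpha m t H1); unfold p in *; lra. }
  assert (Hdp : forall t, between a b t -> is_derive p t (2 * t * Rpower (p t) beta)).
  { intros t Ht; apply is_derive_profile; trivial; apply (Hdef t Ht). }
  assert (HdF : forall t, between a b t -> is_derive F t (sqrt (1 - p t))).
  { intros t Ht; rewrite <- Hrad; auto. }
  assert (Hloc : forall r, between a b r -> locally r (fun t => s * F t = f t)).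
  { intros r Hr; apply (filter_imp (between a b)); auto using between_locally.
    intros; symmetry; auto. }
  assert (Hsm : smooth_on f a b).
  { intros n r Hr. apply (ex_derive_n_ext_loc (fun t => s * F t)); [auto|].
    apply (smooth_of_derivative_closed a b (translator_class F p)); trivial.
    - apply (translator_class_derive F p a b beta); auto.
    - repeat constructor. }
  assert (HD1 : forall r, between a b r -> Derive f r = s * sqrt (1 - p r)).
  { intros r Hr. rewrite <- (Derive_ext_loc _ _ r (Hloc r Hr)), Derive_scal.
    f_equal; apply is_derive_unique; auto. }
  assert (HD2 : forall r, between a b r ->
    Derive_n f 2 r = s * (- (r * Rpower (p r) beta) / sqrt (1 - p r))).
  { intros r Hr. simpl.
    rewrite (Derive_ext_loc _ (fun t => s * sqrt (1 - p t))).
    - rewrite Derive_scal; f_equal; apply is_derive_unique. evar_last.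
      { apply is_derive_slope; [apply (Hp r Hr)|apply (Hdp r Hr)]. }
      assert (0 < sqrt (1 - p r)) by (apply sqrt_lt_R0; pose proof (Hp r Hr); lra).
      field; lra.
    - apply (filter_imp (between a b)); auto using between_locally. }
  split; [exact Hab|split; [exact Hsm|]].
  apply revolution_translator_iff; trivial.
  intros r Hr. pose proof (Hp r Hr) as Hpr.
  assert (Hq : 0 < sqrt (1 - p r)) by (apply sqrt_lt_R0; lra).
  assert (Hsq : Derive f r ^ 2 = 1 - p r).
  { rewrite HD1, Rpow_mult_distr, pow2_sqrt by (auto; lra).
    replace (s ^ 2) with (s * s) by ring. rewrite sign_square by exact Hs; ring. }
  assert (Hk : revolution_curvature f r = Rpower (p r) (- (1 / (2 * alpha)))).
  { unfold revolution_curvature. rewrite Hsq, HD1, HD2 by exact Hr.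
    pose proof (between_pos a b r Hab Hr) as Hr0.
    replace (1 - (1 - p r)) with (p r) by ring.
    (* The exponent is [beta - 2]: the product [f' f''] contributes [p^beta] and the denominator of
       the curvature contributes [p^2]. *)
    replace (- (1 / (2 * alpha))) with (beta + - (2)) by (unfold beta; ring).
    rewrite Rpower_plus, Rpower_Ropp, (Rpower_pow 2) by lra.
    transitivity (s * s * Rpower (p r) beta / p r ^ 2); [field; lra|].
    rewrite sign_square by exact Hs. field; lra. }
  assert (Hkp : 0 < revolution_curvature f r) by (rewrite Hk; apply exp_pos).
  rewrite Hsq. split; [lra|split; [exact Hkp|]].
  replace (1 - (1 - p r)) with (p r) by ring.
  apply Rpower_eq_inv_sqrt; trivial; lra.
Qed.

(** Separation of variables: [ln p - t^2] is a first integral when beta is 1, and [p^k - k t^2] with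
    [k = 1 - beta] otherwise. Its constant value determines [m]. *)
Lemma profile_ode (alpha : R) (p : R -> R) (a b : Rbar) :
  alpha <> 0 -> positive_interval a b ->
  (forall t, between a b t -> 0 < p t < 1) ->
  (forall t, between a b t -> is_derive p t (2 * t * Rpower (p t) (2 - 1 / (2 * alpha)))) ->
  exists m, (alpha = 1 / 2 -> 1 < m) /\
    forall t, between a b t -> profile_defined alpha m t /\ profile alpha m t = p t.
Proof.
  intros Ha Hab Hp Hdp. destruct (between_inhabited a b Hab) as [r0 Hr0].
  unfold profile, radicand, profile_defined.
  destruct (Req_EM_T alpha (1 / 2)) as [E|E].
  - set (c := ln (p r0) - r0 ^ 2).
    assert (Hc : forall t, between a b t -> ln (p t) = c + t ^ 2).
    { intros t Ht. cut (ln (p t) - t ^ 2 = c); [lra|].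
      apply (derive_zero_constant a b (fun t => ln (p t) - t ^ 2)); trivial.
      intros x Hx. pose proof (Hp x Hx) as Hpx. pose proof (Hdp x Hx) as Hd.
      replace (2 - 1 / (2 * alpha)) with 1 in Hd by (subst; field).
      rewrite Rpower_1 in Hd by lra.
      evar_last.
      { apply (is_derive_minus (fun t => ln (p t)) (fun t => t ^ 2)).
        - apply (is_derive_comp ln p); [|exact Hd].
          apply is_derive_Reals, derivable_pt_lim_ln; lra.
        - apply (is_derive_pow (fun t => t) 2), is_derive_Reals, derivable_pt_lim_id. }
      unfold scal, minus, plus, opp; simpl; unfold mult; simpl. field; lra. }
    assert (Hm : exp (- c / 2) ^ 2 = / exp c).
    { simpl; rewrite Rmult_1_r, <- exp_plus, <- exp_Ropp; f_equal; field. }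
    (* Chosen so that [1 / m^2 = exp c]. Since [p < 1] at [r0], [c] is negative, whence [m > 1]. *)
    exists (exp (- c / 2)). split.
    + intros _. rewrite <- exp_0; apply exp_increasing.
      assert (ln (p r0) < 0).
      { rewrite <- ln_1; apply ln_increasing; apply (Hp r0 Hr0). }
      pose proof (pow2_ge_0 r0). unfold c; lra.
    + intros t Ht. split; [apply Rgt_not_eq, exp_pos|].
      rewrite Hm. pose proof (exp_pos c).
      transitivity (exp c * exp (t ^ 2)); [field; lra|].
      rewrite <- exp_plus, <- Hc by exact Ht. apply exp_ln, (Hp t Ht).
  (* [k] is the inverse of the exponent in the formula, so raising [p^k] to that exponent returns
     [p]. *)
  - set (k := (1 - 2 * alpha) / (2 * alpha)).
    assert (Hk : k <> 0).
    { unfold k; apply Rmult_integral_contrapositive; split; [lra|].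
      apply Rinv_neq_0_compat; lra. }
    set (m := Rpower (p r0) k - k * r0 ^ 2).
    assert (Hm : forall t, between a b t -> power_base alpha m t = Rpower (p t) k).
    { intros t Ht. unfold power_base.
      replace ((2 * alpha - 1) / (2 * alpha)) with (- k) by (unfold k; field; exact Ha).
      cut (Rpower (p t) k - k * t ^ 2 = m); [lra|].
      apply (derive_zero_constant a b (fun t => Rpower (p t) k - k * t ^ 2)); trivial.
      intros x Hx. evar_last.
      { apply (is_derive_minus (fun t => Rpower (p t) k) (fun t => k * t ^ 2)).
        - apply is_derive_Rpower; [apply (Hp x Hx)|apply (Hdp x Hx)].
        - apply (is_derive_scal (fun t => t ^ 2)),
            (is_derive_pow (fun t => t) 2), is_derive_Reals, derivable_pt_lim_id. }
      unfold scal, minus, plus, opp; cbn -[Rpower].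
      replace (2 - 1 / (2 * alpha)) with (- (k - 1)) by (unfold k; field; exact Ha).
      rewrite Rpower_Ropp.
      assert (0 < Rpower (p x) (k - 1)) by apply exp_pos.
      field; lra. }
    exists m. split; [contradiction|].
    intros t Ht. rewrite Hm by exact Ht. split; [apply exp_pos|].
    rewrite Rpower_mult.
    replace (k * (2 * alpha / (1 - 2 * alpha))) with 1 by (unfold k; field; lra).
    rewrite Rpower_1 by apply (Hp t Ht). ring.
Qed.

Lemma translator_formula (alpha : R) (f : R -> R) (a b : Rbar) :
  alpha <> 0 -> rotational_K_translator alpha f a b ->
  exists s m : R,
    (s = 1 \/ s = -1) /\ (alpha = 1 / 2 -> 1 < m) /\
    given_by_formula alpha s m f a b.
Proof.
  intros Ha (Hab & Hf & HK).
  pose proof (proj1 (revolution_translator_iff alpha f a b Hab Hf) HK) as H. clear HK.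
  set (p := fun r => 1 - Derive f r ^ 2).
  assert (Hd1 : forall r, between a b r -> is_derive f r (Derive f r)).
  { intros r Hr; apply Derive_correct; exact (Hf 1%nat r Hr). }
  assert (Hd2 : forall r, between a b r -> is_derive (Derive f) r (Derive_n f 2 r)).
  { intros r Hr; apply (Derive_correct (Derive f)); exact (Hf 2%nat r Hr). }
  assert (Hnz : forall r, between a b r -> Derive f r <> 0).
  { intros r Hr E. destruct (H r Hr) as (_ & Hk & _).
    unfold revolution_curvature in Hk. rewrite E in Hk.
    unfold Rdiv in Hk. rewrite !Rmult_0_l, Ropp_0, Rmult_0_l in Hk. lra. }
  assert (Hp : forall r, between a b r -> 0 < p r < 1).
  { intros r Hr. pose proof (proj1 (H r Hr)). pose proof (pow2_gt_0 _ (Hnz r Hr)).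
    unfold p; lra. }
  destruct (profile_ode alpha p a b Ha Hab Hp) as (m & Hm1 & Hm).
  { intros r Hr. destruct (H r Hr) as (Hsp & Hk & HKa). pose proof (Hp r Hr) as Hpr.
    fold (p r) in HKa. apply Rpower_eq_inv_sqrt in HKa; trivial; [|lra].
    pose proof (between_pos a b r Hab Hr) as Hr0.
    evar_last.
    { apply (is_derive_minus (fun _ => 1) (fun t => Derive f t ^ 2)).
      - apply is_derive_const.
      - apply (is_derive_pow (Derive f) 2), Hd2, Hr. }
    (* Both [p' = - 2 f' f''] and the curvature contain the product [f' f'']; eliminating it leaves
       an equation in [p] alone. *)
    transitivity (2 * r * p r ^ 2 * revolution_curvature f r).
    - unfold revolution_curvature. fold (p r).
      unfold minus, plus, opp, zero; cbn -[Derive_n Derive p]. field; lra.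
    - rewrite HKa. unfold Rminus.
      rewrite (Rpower_plus 2), (Rpower_pow 2) by lra. ring. }
  destruct (nonzero_constant_sign a b (Derive f)) as (s & Hs & Hsf); trivial.
  { now apply between_inhabited. }
  { intros t Ht; apply derivable_continuous_pt; exists (Derive_n f 2 t).
    apply is_derive_Reals, Hd2, Ht. }
  exists s, m. split; [exact Hs|split; [exact Hm1|]].
  assert (Hrad : forall t, between a b t -> radicand alpha m t = Derive f t ^ 2).
  { intros t Ht. destruct (Hm t Ht) as [_ E]. unfold profile, p in E; lra. }
  split.
  - intros t Ht. split; [apply (Hm t Ht)|].
    rewrite Hrad by exact Ht; apply pow2_ge_0.
  (* Since [s f' > 0], the root of [f'^2] is [s f'], so [s f] is an antiderivative; multiplying by
     [s] again recovers [f]. *)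
  - exists (fun t => s * f t). split.
    + intros t Ht. rewrite Hrad by exact Ht.
      replace (Derive f t ^ 2) with ((s * Derive f t) ^ 2)
        by (transitivity (s * s * Derive f t ^ 2); [ring|rewrite (sign_square s Hs); ring]).
      rewrite sqrt_pow2 by (left; apply Hsf, Ht).
      apply (is_derive_scal f), Hd1, Ht.
    + intros r Hr. rewrite <- Rmult_assoc, sign_square by exact Hs. ring.
Qed.

(** * Existence of the antiderivative, and the shape of maximal domains *)

Lemma formula_exists (alpha s m : R) (a b : Rbar) :
  alpha <> 0 -> positive_interval a b ->
  (forall t, between a b t -> formula_defined alpha m t) ->
  exists f, given_by_formula alpha s m f a b.
Proof.
  intros Ha Hab Hdef. destruct (between_inhabited a b Hab) as [x0 Hx0].
  set (q := fun t => sqrt (radicand alpha m t)).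
  assert (Hc : forall t, between a b t -> continuous q t).
  { intros t Ht. apply (continuous_comp (radicand alpha m) sqrt).
    - apply (continuous_ext (fun x => minus 1 (profile alpha m x))).
      { intros x; apply (Rminus_diag_uniq (minus _ _)).
        unfold profile, minus, plus, opp; simpl; ring. }
      apply (continuous_minus (fun _ => 1)); [apply continuous_const|].
      apply (ex_derive_continuous (profile alpha m)). eexists.
      apply is_derive_profile; [exact Ha|apply (Hdef t Ht)].
    - apply continuous_sqrt. }
  exists (fun r => s * RInt q x0 r). split; [exact Hdef|].
  exists (RInt q x0). split; [|reflexivity].
  intros t Ht. apply (is_derive_RInt q (RInt q x0) x0 t); [|exact (Hc t Ht)].
  apply (filter_imp (between a b)); [|now apply between_locally].
  intros x Hx. apply (RInt_correct q), ex_RInt_continuous.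
  intros z Hz. apply Hc. revert Hz; unfold Rmin, Rmax.
  destruct (Rle_dec x0 x); intros Hz.
  - exact (between_convex a b x0 x z Hx0 Hx Hz).
  - exact (between_convex a b x x0 z Hx Hx0 Hz).
Qed.

(** The strict range yields admissibility. For maximality, the existence clause of
    [admissible_domain] forces the formula to be defined on any competing interval, whose squares
    then lie in [[A, B]]. *)
Lemma maximal_domain_of_squares (alpha s m A B : R) :
  alpha <> 0 -> s = 1 \/ s = -1 -> 0 <= A < B ->
  (forall t, 0 < t -> A < t ^ 2 < B -> profile_defined alpha m t /\ 0 < radicand alpha m t) ->
  (forall t, 0 < t -> formula_defined alpha m t -> A <= t ^ 2 <= B) ->
  maximal_domain alpha s m (Finite (sqrt A)) (Finite (sqrt B)).
Proof.
  intros Ha Hs HAB H1 H2.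
  pose proof (sqrt_pos A) as HA. pose proof (sqrt_lt_1_alt A B HAB) as Hlt.
  assert (Hab : positive_interval (Finite (sqrt A)) (Finite (sqrt B))) by now split.
  assert (Hd : forall t, between (Finite (sqrt A)) (Finite (sqrt B)) t ->
    profile_defined alpha m t /\ 0 < radicand alpha m t).
  { intros t [Ht1 Ht2]; simpl in *. apply H1; [lra|].
    assert (HA2 := pow2_sqrt A ltac:(lra)). assert (HB2 := pow2_sqrt B ltac:(lra)).
    split; nra. }
  split; [split; [exact Hab|split]|].
  - apply formula_exists; trivial. intros t Ht. destruct (Hd t Ht).
    split; [assumption|lra].
  - intros f; now apply formula_translator.
  - intros c d (Hcd & [f [Hf _]] & _). apply endpoints_le; trivial.
    intros t Ht. pose proof (between_pos c d t Hcd Ht) as Ht0.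
    pose proof (H2 t Ht0 (Hf t Ht)).
    rewrite <- (sqrt_pow2 t) by lra. split; apply sqrt_le_1_alt; lra.
Qed.

Lemma empty_domain_of_undefined (alpha s m : R) :
  (forall t, 0 < t -> ~ formula_defined alpha m t) -> empty_domain alpha s m.
Proof.
  intros H a b (Hab & [f [Hf _]] & _).
  destruct (between_inhabited a b Hab) as [t Ht].
  exact (H t (between_pos a b t Hab Ht) (Hf t Ht)).
Qed.

(** * Sign of the radicand in each range of alpha *)

Lemma Rpower_lt_1 (x e : R) : 0 < x -> e * ln x < 0 -> Rpower x e < 1.
Proof. intros Hx H; rewrite <- exp_0; now apply exp_increasing. Qed.

Lemma Rpower_gt_1 (x e : R) : 0 < x -> 0 < e * ln x -> 1 < Rpower x e.
Proof. intros Hx H; rewrite <- exp_0; now apply exp_increasing. Qed.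

Lemma ln_neg (x : R) : 0 < x < 1 -> ln x < 0.
Proof. intros Hx; rewrite <- ln_1; apply ln_increasing; lra. Qed.

Lemma ln_pos (x : R) : 1 < x -> 0 < ln x.
Proof. intros Hx; rewrite <- ln_1; apply ln_increasing; lra. Qed.

(** Writing [m^2] as [exp (ln (m^2))] turns the radicand into [1 - exp (t^2 - ln (m^2))]. The strict
    equivalence serves admissibility, the other one maximality and emptiness. *)
Lemma half_radicand (m t : R) :
  m <> 0 ->
  (0 < radicand (1 / 2) m t <-> t ^ 2 < ln (m ^ 2)) /\
  (0 <= radicand (1 / 2) m t <-> t ^ 2 <= ln (m ^ 2)).
Proof.
  intros Hm. unfold radicand. destruct (Req_EM_T (1 / 2) (1 / 2)) as [_|n]; [|now destruct n].
  pose proof (pow2_gt_0 m Hm) as Hm2.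
  rewrite <- (exp_ln (m ^ 2)) at 1 3 by exact Hm2.
  replace (1 - 1 / exp (ln (m ^ 2)) * exp (t ^ 2)) with (1 - exp (t ^ 2 - ln (m ^ 2))).
  2: { unfold Rminus at 2; rewrite exp_plus, exp_Ropp. field. apply Rgt_not_eq, exp_pos. }
  rewrite <- exp_0 at 1 2. split; split; intros H.
  - apply Rminus_lt, exp_lt_inv. lra.
  - enough (exp (t ^ 2 - ln (m ^ 2)) < exp 0) by lra. apply exp_increasing; lra.
  - destruct (Rle_or_lt (t ^ 2) (ln (m ^ 2))) as [|C]; [assumption|].
    enough (exp 0 < exp (t ^ 2 - ln (m ^ 2))) by lra. apply exp_increasing; lra.
  - destruct H as [H|H].
    + enough (exp (t ^ 2 - ln (m ^ 2)) < exp 0) by lra. apply exp_increasing; lra.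
    + rewrite H, Rminus_diag. lra.
Qed.

(** The power is the exponential of exponent times [ln base], so the sign of that product decides
    whether it is below 1. *)
Lemma radicand_pos (alpha m t : R) :
  alpha <> 1 / 2 -> 0 < power_base alpha m t ->
  2 * alpha / (1 - 2 * alpha) * ln (power_base alpha m t) < 0 ->
  profile_defined alpha m t /\ 0 < radicand alpha m t.
Proof.
  intros Ha Hb H. unfold profile_defined, radicand.
  destruct (Req_EM_T alpha (1 / 2)) as [|_]; [contradiction|].
  split; [exact Hb|]. pose proof (Rpower_lt_1 _ _ Hb H); lra.
Qed.

Lemma formula_defined_power_base (alpha m t : R) :
  alpha <> 1 / 2 -> formula_defined alpha m t ->
  0 < power_base alpha m t /\
  2 * alpha / (1 - 2 * alpha) * ln (power_base alpha m t) <= 0.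
Proof.
  intros Ha. unfold formula_defined, radicand.
  destruct (Req_EM_T alpha (1 / 2)) as [|_]; [contradiction|].
  intros [Hb H]; split; [exact Hb|]. apply Rnot_lt_le; intros C.
  pose proof (Rpower_gt_1 _ _ Hb C); lra.
Qed.

Lemma exponent_pos (alpha : R) :
  0 < alpha < 1 / 2 -> 0 < 2 * alpha / (1 - 2 * alpha).
Proof. intros H; apply Rdiv_lt_0_compat; lra. Qed.

Lemma exponent_neg (alpha : R) :
  ~ (0 <= alpha <= 1 / 2) -> 2 * alpha / (1 - 2 * alpha) < 0.
Proof.
  intros H. destruct (Rlt_or_le alpha 0) as [H0|H0].
  - apply Rdiv_neg_pos; lra.
  - assert (1 / 2 < alpha) by (apply Rnot_le_lt; tauto).
    apply Rdiv_pos_neg; lra.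
Qed.

(** With [e] the exponent, [base = m + t^2 / e]. Solved for [t^2], this converts bounds on the base
    into bounds on [t^2], reversed when [e] is negative. *)
Lemma power_base_exponent (alpha m t : R) :
  alpha <> 0 -> alpha <> 1 / 2 ->
  2 * alpha / (1 - 2 * alpha) * (power_base alpha m t - m) = t ^ 2.
Proof. intros H0 H1; unfold power_base; field; lra. Qed.

(** The exponent is positive here, so the power is at most 1 only for a base at most 1. Both bounds
    matter: the lower one produces the inner radius when [m < 0]. *)
Lemma small_alpha_bounds (alpha m t : R) :
  0 < alpha < 1 / 2 -> formula_defined alpha m t ->
  0 < power_base alpha m t <= 1.
Proof.
  intros Ha Hd. destruct (formula_defined_power_base alpha m t ltac:(lra) Hd) as [Hb H].
  split; [exact Hb|]. apply Rnot_lt_le; intros C.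
  pose proof (Rmult_lt_0_compat _ _ (exponent_pos alpha Ha) (ln_pos _ C)); lra.
Qed.

Lemma small_alpha_radicand_pos (alpha m t : R) :
  0 < alpha < 1 / 2 -> 0 < power_base alpha m t < 1 ->
  profile_defined alpha m t /\ 0 < radicand alpha m t.
Proof.
  intros Ha Hb. apply radicand_pos; [lra..|].
  pose proof (exponent_pos alpha Ha). pose proof (ln_neg _ Hb). nra.
Qed.

(** The exponent is negative here, so a base below 1 would push the power above 1. *)
Lemma large_alpha_bounds (alpha m t : R) :
  alpha <> 1 / 2 -> ~ (0 <= alpha <= 1 / 2) -> formula_defined alpha m t ->
  1 <= power_base alpha m t.
Proof.
  intros Ha1 Ha Hd. destruct (formula_defined_power_base alpha m t Ha1 Hd) as [Hb H].
  apply Rnot_lt_le; intros C.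
  pose proof (exponent_neg alpha Ha). pose proof (ln_neg _ (conj Hb C)). nra.
Qed.

Lemma large_alpha_radicand_pos (alpha m t : R) :
  alpha <> 1 / 2 -> ~ (0 <= alpha <= 1 / 2) -> 1 < power_base alpha m t ->
  profile_defined alpha m t /\ 0 < radicand alpha m t.
Proof.
  intros Ha1 Ha Hb. apply radicand_pos; [exact Ha1|lra|].
  pose proof (exponent_neg alpha Ha). pose proof (ln_pos _ Hb). nra.
Qed.

(** * Assembly of the classification and of the three ranges of alpha *)

Theorem theorem3p2 (alpha : R) (halpha : alpha <> 0) :
  (forall (f : R -> R) (a b : Rbar),
     rotational_K_translator alpha f a b ->
     exists s m : R,
       (s = 1 \/ s = -1) /\ (alpha = 1 / 2 -> 1 < m) /\
       given_by_formula alpha s m f a b)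
  /\
  (forall s m : R, s = 1 \/ s = -1 ->
     (alpha = 1 / 2 ->
        (1 < m ->
           maximal_domain alpha s m (Finite 0) (Finite (sqrt (ln (m ^ 2))))) /\
        (Rabs m <= 1 -> empty_domain alpha s m))
     /\
     (0 < alpha < 1 / 2 ->
        (m < 0 ->
           maximal_domain alpha s m
             (Finite (sqrt (2 * alpha / (2 * alpha - 1) * m)))
             (Finite (sqrt (2 * alpha / (1 - 2 * alpha) * (1 - m))))) /\
        (0 <= m < 1 ->
           maximal_domain alpha s m (Finite 0)
             (Finite (sqrt (2 * alpha / (1 - 2 * alpha) * (1 - m))))) /\
        (1 <= m -> empty_domain alpha s m))
     /\
     (~ (0 <= alpha <= 1 / 2) ->
        (1 < m ->
           maximal_domain alpha s m (Finite 0)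
             (Finite (sqrt (2 * alpha / (2 * alpha - 1) * (m - 1))))) /\
        (m <= 1 -> empty_domain alpha s m))).
Proof.
  split; [intros f a b; now apply translator_formula|].
  intros s m Hs. split; [|split].
  - intros ->. assert (Hdef : forall t, profile_defined (1 / 2) m t <-> m <> 0).
    { intros t; unfold profile_defined.
      destruct (Req_EM_T (1 / 2) (1 / 2)) as [_|n]; [tauto|now destruct n]. }
    split.
    + intros Hm. rewrite <- sqrt_0. apply maximal_domain_of_squares; trivial.
      * split; [lra|]. apply ln_pos; nra.
      * intros t Ht HB. split; [apply Hdef; lra|]. apply half_radicand; lra.
      * intros t Ht [_ H]. split; [apply pow2_ge_0|]. apply half_radicand; [lra|exact H].
    + intros Hm. apply empty_domain_of_undefined. intros t Ht [H0 H].
      (* Definedness excludes [m = 0]; for the remaining [m], [ln (m^2) <= 0 < t^2]. *)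
      apply Hdef in H0. apply half_radicand in H; [|exact H0].
      assert (m ^ 2 <= 1).
      { rewrite <- pow2_abs. pose proof (Rabs_pos m). nra. }
      assert (ln (m ^ 2) <= ln 1) by (apply ln_le; [now apply pow2_gt_0|assumption]).
      rewrite ln_1 in *. pose proof (pow_lt t 2 Ht). lra.
  - intros Ha. pose proof (exponent_pos alpha Ha) as He.
    assert (Hpb := fun t => power_base_exponent alpha m t halpha ltac:(lra)).
    set (e := 2 * alpha / (1 - 2 * alpha)) in *. split; [|split].
    + intros Hm.
      replace (2 * alpha / (2 * alpha - 1) * m) with (- e * m) by (unfold e; field; lra).
      apply maximal_domain_of_squares; trivial.
      * nra.
      (* With [t^2 = e * (base - m)] and [e > 0], the bounds [- e * m] and [e * (1 - m)] say exactly
         [0 < base < 1]. *)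
      * intros t Ht. rewrite <- Hpb. intros HB. apply small_alpha_radicand_pos; trivial. nra.
      * intros t Ht H. rewrite <- Hpb. pose proof (small_alpha_bounds alpha m t Ha H). nra.
    + intros Hm. rewrite <- sqrt_0. apply maximal_domain_of_squares; trivial.
      * nra.
      (* Now [t^2 > 0] gives [base > m >= 0], so the lower bound on the base holds down to the
         axis. *)
      * intros t Ht. rewrite <- Hpb. intros HB. apply small_alpha_radicand_pos; trivial. nra.
      * intros t Ht H. split; [apply pow2_ge_0|].
        rewrite <- Hpb. pose proof (small_alpha_bounds alpha m t Ha H). nra.
    (* A base at most 1 and [m >= 1] would make [t^2 = e * (base - m)] nonpositive. *)
    + intros Hm. apply empty_domain_of_undefined. intros t Ht H.
      pose proof (small_alpha_bounds alpha m t Ha H).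
      pose proof (pow_lt t 2 Ht) as Ht2. rewrite <- Hpb in Ht2. nra.
  - intros Ha. assert (Ha1 : alpha <> 1 / 2) by lra.
    pose proof (exponent_neg alpha Ha) as He.
    assert (Hpb := fun t => power_base_exponent alpha m t halpha Ha1).
    set (e := 2 * alpha / (1 - 2 * alpha)) in *. split.
    + intros Hm.
      replace (2 * alpha / (2 * alpha - 1) * (m - 1)) with (- e * (m - 1))
        by (unfold e; field; lra).
      rewrite <- sqrt_0. apply maximal_domain_of_squares; trivial.
      * nra.
      (* Dividing [e * (base - m) < - e * (m - 1)] by the negative [e] gives [base > 1]. *)
      * intros t Ht. rewrite <- Hpb. intros HB. apply large_alpha_radicand_pos; trivial. nra.
      * intros t Ht H. split; [apply pow2_ge_0|].
        rewrite <- Hpb. pose proof (large_alpha_bounds alpha m t Ha1 Ha H). nra.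
    (* Here [base >= 1 >= m] and [e < 0] would make [t^2] nonpositive. *)
    + intros Hm. apply empty_domain_of_undefined. intros t Ht H.
      pose proof (large_alpha_bounds alpha m t Ha1 Ha H).
      pose proof (pow_lt t 2 Ht) as Ht2. rewrite <- Hpb in Ht2. nra.
Qed.
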